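(* For $n\ge 3$, let $S_2(n)$ be the minimum size of a 2-CNF encoding of $\mathrm{AMO}_n$. Then: (1) if $n\le 10$, then $S_2(n)=3n-6$; (2) if $n\ge 9$, then $S_2(n)\ge 2n+2\sqrt{n}-3$.
   Context: A CNF formula is a conjunction of clauses (disjunctions of literals with no complementary pair); its size is the number of clauses; a 2-CNF formula has every clause of at most two literals. $\mathrm{AMO}_n(x_1,\dots,x_n)$ is the boolean function equal to $1$ iff at most one $x_i$ equals $1$. A CNF formula $\varphi(\mathbf{x},\mathbf{y})$ with input variables $\mathbf{x}=(x_1,\dots,x_n)$ and auxiliary variables $\mathbf{y}=(y_1,\dots,y_\ell)$ is an encoding of $f(\mathbf{x})$ if for all $\alpha\in\{0,1\}^n$: $f(\alpha)=1$ iff there exists $\beta\in\{0,1\}^\ell$ with $\varphi(\alpha,\beta)=1$ (propagation completeness is not required). *)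

(* Defs.v *)
From mathcomp Require Import all_boot all_order all_algebra.
From mathcomp Require Import boolp reals.

Set Implicit Arguments.
Unset Strict Implicit.
Unset Printing Implicit Defensive.

(* [(v, true)] is the literal v and [(v, false)] its negation; a clause is a
   set of literals and a formula is a set of clauses, so that the size of a
   formula [phi] is [#|phi|]. *)
Notation literal V := (V * bool)%type.
Notation cnf V := {set {set literal V}}.

Definition is_clause (V : finType) (C : {set literal V}) : bool :=
  [forall v : V, ~~ (((v, true) \in C) && ((v, false) \in C))].

Definition is_cnf (V : finType) (phi : cnf V) : bool :=
  [forall C in phi, is_clause C].

Definition is_2cnf (V : finType) (phi : cnf V) : bool :=
  is_cnf phi && [forall C in phi, #|C| <= 2].

Definition eval_lit (V : finType) (a : V -> bool) (x : literal V) : bool :=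
  a x.1 == x.2.

Definition eval_cnf (V : finType) (a : V -> bool) (phi : cnf V) : bool :=
  [forall C in phi, [exists x in C, eval_lit a x]].

(* Input variables are [inl i], auxiliary variables are [inr j]. *)
Definition assign (n l : nat) (a : {ffun 'I_n -> bool}) (b : {ffun 'I_l -> bool})
    (v : 'I_n + 'I_l) : bool :=
  match v with inl i => a i | inr j => b j end.

Definition encodes (n l : nat) (phi : cnf ('I_n + 'I_l)%type)
    (f : {ffun 'I_n -> bool} -> bool) : Prop :=
  forall a : {ffun 'I_n -> bool},
    f a <-> exists b : {ffun 'I_l -> bool}, eval_cnf (assign a b) phi.

Definition AMO (n : nat) (a : {ffun 'I_n -> bool}) : bool :=
  #|[set i | a i]| <= 1.

Definition AMO_2cnf_size (n s : nat) : Prop :=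
  exists (l : nat) (phi : cnf ('I_n + 'I_l)%type),
    [/\ is_2cnf phi, encodes phi (@AMO n) & #|phi| = s].

Lemma AMO_2cnf_size_ex (n : nat) : exists s, `[< AMO_2cnf_size n s >].
Proof.
pose V := ('I_n + 'I_0)%type.
pose cl (p : 'I_n * 'I_n) : {set literal V} :=
  [set (inl p.1, false); (inl p.2, false)].
pose phi : cnf V := [set cl p | p in [set p : 'I_n * 'I_n | p.1 != p.2]].
exists #|phi|; apply/asboolP; exists 0, phi; split=> //.
- apply/andP; split; apply/forall_inP => C /imsetP[p _ ->].
    by apply/forallP => v; rewrite !inE !xpair_eqE !andbF.
  by rewrite cards2; case: (_ != _).
- move=> a; split.
    move=> /card_le1_eqP ha; exists [ffun=> true]; apply/forall_inP => C.
    case/imsetP=> -[i j]; rewrite inE /= => nij ->.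
    case ai: (a i).
      apply/existsP; exists (inl j, false).
      rewrite !inE eqxx orbT /eval_lit /=; apply/eqP/negbTE/negP => aj.
      by move: nij; rewrite (ha i j) ?inE ?eqxx.
    by apply/existsP; exists (inl i, false); rewrite !inE eqxx /eval_lit /= ai.
case=> b /forall_inP hb; apply/card_le1_eqP => i j; rewrite !inE => ai aj.
apply/eqP; apply/negPn/negP => nij.
have /existsP[x] : [exists x in cl (i, j), eval_lit (assign a b) x].
  by apply: hb; apply: imset_f; rewrite inE /= eq_sym.
by rewrite !inE => /andP[/orP[]/eqP-> /eqP /=]; rewrite ?ai ?aj.
Qed.

Definition S2 (n : nat) : nat := ex_minn (AMO_2cnf_size_ex n).

(* Main.v *)
(* Generalise the inputs to literals of a 2-CNF formula that are individually
   satisfiable and pairwise contradictory, and induct on the number of clauses.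

   If at most one clause contains the negation of an input z, replace z by the
   other literal of that clause and save it. If at least three do, set z false.
   If two inputs share a clause, set one of them false and replace the other.
   Each time either n is unchanged and a clause is saved, or n drops by 1 and
   three clauses are saved.

   Otherwise every input z has exactly two clauses, z -> p and z -> q, and these
   2n clauses are distinct. Among all such partner literals take u implied by as
   few inputs as possible, say by the a inputs of Z. Setting u and Z to false
   saves 2a clauses plus those containing the negation of u, of which there are
   at least two (else u could be eliminated). On the other hand each z in Z has
   one partner which all of Z implies, so the conflicts inside Z come from the
   other partners, which therefore form an at-most-one encoding for a inputs
   within the clauses free of inputs. Hence the size is at least both
   S(n - a) + 2a + 2 and 2n + S(a); one of them can be improved slightly
   depending on whether the negation of u is a partner too. The existence of
   common models is always obtained from closure of 2-CNF under majority.

   The upper bound is the sequential encoding. *)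
Require Import Defs.
From mathcomp Require Import all_boot all_order all_algebra.
From mathcomp Require Import boolp reals.
From mathcomp Require Import zify.

Set Implicit Arguments.
Unset Strict Implicit.
Unset Printing Implicit Defensive.
Import GRing.Theory Num.Theory.

(** * Arithmetic of the lower bound *)

(* For [n > 10] this is [2 n + 2 sqrt n - 3 <= s] squared; the truncated
   subtraction is harmless because the inequality fails when it gives [0]. *)
Definition size_bound (n s : nat) : bool :=
  if n <= 10 then 3 * n - 6 <= s else 4 * n <= (s + 3 - 2 * n) ^ 2.

Lemma size_bound_mono n s t : s <= t -> size_bound n s -> size_bound n t.
Proof.
rewrite /size_bound; case: ifP => _ st; first by move/leq_trans; apply.
by move/leq_trans; apply; rewrite leq_exp2r //; lia.
Qed.

Lemma size_bound_small n s : n <= 2 -> size_bound n s.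
Proof. by case: n => [|[|[]]]. Qed.

(** Passing from [n.-1] to [n] adds 1 to the base of the square and 4 to its target, and
    [(k + 1) ^ 2 - k ^ 2 >= 4] for [k >= 2]. Where the two regimes meet, at [n = 11], the base is at
    least 8. *)
Lemma size_bound_step n s t : 3 < n -> size_bound n.-1 s -> s + 3 <= t -> size_bound n t.
Proof.
move=> n3; rewrite /size_bound => h st; move: h.
case: ifP => h1; case: ifP => h2; [lia| |lia|]; rewrite -?mulnn.
  move=> h3; have -> : n = 11 by lia.
  have h : 8 <= t + 3 - 2 * 11 by lia.
  by move: (leq_mul h h); lia.
set k := s + 3 - _ => h3.
have : k + 1 <= t + 3 - 2 * n by lia.
by move=> h; move: (leq_mul h h); nia.
Qed.

(** For small [a] the first inequality suffices, for large [a] the second. The disjunction decides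
    [n = 10], [a = 3], where the first two inequalities only yield 23 instead of 24. *)
Lemma size_bound_source n a s s2 s3 :
  3 < n -> 0 < a <= n -> size_bound (n - a) s2 -> size_bound a s3 ->
  s2 + 2 * a + 2 <= s -> 2 * n + s3 <= s ->
  (s2 + 2 * a + 3 <= s) || (2 * n + s3 + 2 <= s) -> size_bound n s.
Proof.
move=> n3 /andP[a0 an] g2 g3 h1 h2 h3.
rewrite /size_bound in g2 g3 *; case: ifP => n10.
  have [na a10] : n - a <= 10 /\ a <= 10 by lia.
  by rewrite na in g2; rewrite a10 in g3; lia.
have ka : (a <= 2) || (2 * a <= s + 3 - 2 * n).
  case: (leqP a 2) => //= a2; move: g3; case: ifP => a10; first by lia.
  set k := s3 + 3 - _ => k3; have : 0 < k by rewrite -mulnn in k3; nia.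
  by rewrite /k; lia.
have kb : 10 < a \/ 3 * a - 3 <= s + 3 - 2 * n \/ a <= 2.
  by case: (leqP a 10) g3 => a10 g3; [right; lia | left].
set k := s + 3 - 2 * n in ka kb *.
rewrite -mulnn; move: g2; case: ifP => na g2.
  have kn : n - a - 1 <= k by lia.
  have nle : n <= 10 + a by lia.
  have [a3|a3] := leqP a 3.
    have h : 7 + (n - 11) <= k by lia.
    have h' : 7 <= k by lia.
    by have := leq_mul h h'; clear -nle a3 n10; lia.
  have h : 2 * a <= k by lia.
  have h' : 9 <= k by lia.
  by have := leq_mul h h'; lia.
set k2 := s2 + 3 - _ in g2; rewrite -mulnn in g2.
have k21 : 1 < k2.
  by rewrite ltnNge; apply/negP => k21; have := leq_mul k21 k21; lia.
have kk : k2 + 2 <= k by rewrite /k /k2 in k21 *; lia.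
(* If [a <= k2 + 1], then [(k2 + 2) ^ 2 = k2 ^ 2 + 4 * (k2 + 1)] is at least [4 * (n - a) + 4 * a].
   Otherwise [k >= 2 * a] is already large enough. *)
have [ak|ak] := leqP a (k2 + 1).
  by have := leq_mul kk kk; rewrite !mulnDl !mulnDr; lia.
have h : 2 * a <= k by lia.
have h' : k2 + 2 <= a by lia.
have h2a : 2 <= a by lia.
have := leq_mul h2a (leqnn a); have := leq_mul h h; have := leq_mul h' h'.
rewrite !mulnDl !mulnDr; lia.
Qed.

Lemma ex_third (T : eqType) (s : seq T) x y :
  uniq s -> 2 < size s -> exists2 z, z \in s & (z != x) && (z != y).
Proof.
move=> us ss; have [/hasP//|/hasPn h] := boolP (has (fun z => (z != x) && (z != y)) s).
have sub : {subset s <= [:: x; y]}.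
  by move=> z /h; rewrite !inE negb_and !negbK.
by have := uniq_leq_size us sub; rewrite leqNgt ss.
Qed.

Lemma mem_rem_cons (T : eqType) (s : seq T) x y : x \in s ->
  y \in s -> y = x \/ y \in rem x s.
Proof.
by move=> xs; rewrite (perm_mem (perm_to_rem xs)) inE => /orP[/eqP|]; [left|right].
Qed.

(** * Literals, 2-clauses and closure of models under majority *)

Section TwoCnf.
Variable V : eqType.
Notation lit := (V * bool)%type.
(** A clause with one literal is a pair with equal entries. Formulas are sequences, so repeated
    clauses count. *)
Notation clause := (lit * lit)%type.
Implicit Types (a b : V -> bool) (l m u z : lit) (c : clause).
Implicit Types (G zs Ds : seq lit) (F : seq clause).

Definition neg l : lit := (l.1, ~~ l.2).
Definition tr a l := a l.1 == l.2.
Definition holds a c := tr a c.1 || tr a c.2.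

(* The unit clauses [G] are not counted in the size of the formula [F]. *)
Definition model G F a := all (tr a) G && all (holds a) F.

Definition maj a1 a2 a3 : V -> bool :=
  fun v => [|| a1 v && a2 v, a1 v && a3 v | a2 v && a3 v].
Definition upd a l : V -> bool := fun v => if v == l.1 then l.2 else a v.

Definition inc l c := (c.1 == l) || (c.2 == l).
Definition other l c := if c.1 == l then c.2 else c.1.
Definition occ F l := count (inc l) F.

Lemma negK : involutive neg.
Proof. by case=> v b; rewrite /neg /= negbK. Qed.

Lemma neg_eq l m : (neg l == m) = (l == neg m).
Proof. exact: (can2_eq negK negK). Qed.

Lemma neg_neq l : (neg l == l) = false.
Proof. by case: l => v [] /=; rewrite /neg /= xpair_eqE eqxx. Qed.

Lemma tr_neg a l : tr a (neg l) = ~~ tr a l.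
Proof. by case: l => v b; rewrite /tr /=; case: (a v); case: b. Qed.

Lemma tr_maj a1 a2 a3 l : tr (maj a1 a2 a3) l =
  [|| tr a1 l && tr a2 l, tr a1 l && tr a3 l | tr a2 l && tr a3 l].
Proof.
case: l => v b; rewrite /tr /maj /=.
by case: b; case: (a1 v); case: (a2 v); case: (a3 v).
Qed.

Lemma tr_upd a l m : tr (upd a l) m = (m == l) || (m != neg l) && tr a m.
Proof.
case: l m => [v b] [w d]; rewrite /tr /upd /neg /= !xpair_eqE.
by case: (eqVneq w v) => // _; case: b; case: d.
Qed.

Lemma inc_other l c : inc l c -> c = (l, other l c) \/ c = (other l c, l).
Proof.
case: c => c1 c2; rewrite /inc /other /=.
by case: (eqVneq c1 l) => [-> _|_ /= /eqP->]; [left | right].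
Qed.

Lemma holds_other a l c : inc l c -> holds a c = tr a l || tr a (other l c).
Proof. by case/inc_other => {1}->; rewrite /holds //= orbC. Qed.

Lemma inc_other_l l c : inc l c -> inc (other l c) c.
Proof. by case/inc_other => {2}->; rewrite /inc /= eqxx ?orbT. Qed.

Lemma inc2_other l m c : inc l c -> inc m c -> l != m -> other l c = m.
Proof.
case: c => c1 c2; rewrite /inc /other /=.
case: (eqVneq c1 l) => [-> _|_ /= /eqP-> /orP[/eqP//|/eqP->]]; last by rewrite eqxx.
by case/orP => /eqP-> //; rewrite eqxx.
Qed.

Lemma modelP G F a : reflect
  ({in G, forall l, tr a l} /\ {in F, forall c, holds a c}) (model G F a).
Proof. by apply: (iffP andP) => -[/allP ? /allP ?]; split=> //; apply/allP. Qed.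

(** Each of the three models satisfies one of the two literals of a clause, so two models share a
    true literal, and the majority keeps it. *)
Lemma model_maj G F a1 a2 a3 :
  model G F a1 -> model G F a2 -> model G F a3 -> model G F (maj a1 a2 a3).
Proof.
move=> /modelP[g1 f1] /modelP[g2 f2] /modelP[g3 f3]; apply/modelP; split.
  by move=> l lG; rewrite tr_maj g1 ?g2.
move=> c cF; move: (f1 c cF) (f2 c cF) (f3 c cF); rewrite /holds !tr_maj.
by case: (tr a1 c.1); case: (tr a2 c.1); case: (tr a3 c.1);
   case: (tr a1 c.2); case: (tr a2 c.2); case: (tr a3 c.2).
Qed.

Lemma model_upd G F a l : model G F a -> neg l \notin G ->
  {in F, forall c, inc (neg l) c -> tr (upd a l) (other (neg l) c)} ->
  model G F (upd a l).
Proof.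
move=> /modelP[gm fm] lG hF; apply/modelP; split=> [m mG|c cF].
  rewrite tr_upd (gm _ mG) andbT; case: (eqVneq m (neg l)) => [e|]; last by rewrite orbT.
  by rewrite -e mG in lG.
have [i|] := boolP (inc (neg l) c); first by rewrite (holds_other _ i) hF ?orbT.
rewrite /inc negb_or => /andP[n1 n2]; have := fm _ cF.
by rewrite /holds !tr_upd n1 n2 /= => /orP[]->; rewrite !orbT.
Qed.

(** * Generalised inputs and restriction to false literals *)

Definition amo G F zs : Prop :=
  [/\ uniq zs,
      {in zs, forall z, exists2 a, model G F a & tr a z}
    & {in zs &, forall z z' a, model G F a -> tr a z -> tr a z' -> z = z'}].

(** A model of a third input makes [z] or [neg z] true, against the conflicts between inputs. *)
Lemma amo_neg G F zs z : amo G F zs -> 2 < size zs -> z \in zs -> neg z \notin zs.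
Proof.
move=> [us hs hc] ss zz; apply/negP => nz.
have [w wz /andP[w1 w2]] := ex_third z (neg z) us ss.
have [a ma aw] := hs _ wz; have [az|az] := boolP (tr a z).
  by move: w1; rewrite (hc _ _ wz zz a) // eqxx.
by move: w2; rewrite (hc _ _ wz nz a) ?tr_neg // eqxx.
Qed.

Lemma amo_unit G F zs z z' : amo G F zs -> z \in zs -> z' \in zs -> z != z' ->
  z \notin G.
Proof.
move=> [us hs hc] zz zz' ne; apply/negP => zG; have [a ma az'] := hs _ zz'.
by move: ne; rewrite (hc _ _ zz zz' a) ?eqxx //; case/modelP: ma => ->.
Qed.

Lemma amo_negunit G F zs z : amo G F zs -> z \in zs -> neg z \notin G.
Proof.
move=> [us hs hc] /hs[a /modelP[ma _] az]; apply/negP => /ma.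
by rewrite tr_neg az.
Qed.

(** Such clauses are satisfied once all of [Ds] is false, so restriction deletes them and records
    the false literals as uncounted units. *)
Definition touch Ds c := has (fun d => inc (neg d) c) Ds.

Lemma model_restrict G F Ds a :
  model (map neg Ds ++ G) (filter (predC (touch Ds)) F) a =
  model G F a && all (fun d => ~~ tr a d) Ds.
Proof.
have e : all (tr a) (map neg Ds) = all (fun d => ~~ tr a d) Ds.
  by rewrite all_map; apply: eq_all => d /=; rewrite tr_neg.
rewrite /model all_cat e; case: allP => [h|_]; rewrite ?andbF ?andbT //=.
congr (_ && _); rewrite all_filter; apply: eq_in_all => c cF /=.
have [/hasP[d dD i]|//] := boolP (touch Ds c).
by rewrite (holds_other _ i) tr_neg (h _ dD).
Qed.

Lemma amo_restrict G F zs Ds zs' : amo G F zs -> uniq zs' ->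
  {subset zs' <= zs} ->
  {in zs', forall z, exists2 a, model G F a & tr a z && all (fun d => ~~ tr a d) Ds} ->
  amo (map neg Ds ++ G) (filter (predC (touch Ds)) F) zs'.
Proof.
move=> [us hs hc] us' sub sat; split=> // [z /sat[a ma /andP[az aD]]|z z' zz zz' a].
  by exists a; rewrite ?model_restrict ?ma.
by rewrite model_restrict => /andP[ma _]; apply: hc => //; exact: sub.
Qed.

Lemma size_restrict F Ds :
  size (filter (predC (touch Ds)) F) + count (touch Ds) F = size F.
Proof. by rewrite size_filter addnC count_predC. Qed.

Lemma count_touch F Ds : uniq Ds ->
  {in F, forall c, {in Ds &, forall d d', inc (neg d) c -> inc (neg d') c -> d = d'}} ->
  count (touch Ds) F = \sum_(d <- Ds) occ F (neg d).
Proof.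
elim: Ds => [|d Ds IH] /=; first by rewrite big_nil count_pred0.
case/andP=> dD uD hD; rewrite big_cons -IH //; last first.
  by move=> c cF x y xD yD; apply: hD; rewrite // inE ?xD ?yD orbT.
rewrite /occ -count_predUI [X in _ + X](_ : _ = 0) ?addn0 //.
apply/eqP; rewrite -leqn0 leqNgt -has_count; apply/hasPn => c cF /=.
apply/negP => /andP[i /hasP[x xD j]]; move: dD.
by rewrite (hD c cF d x) ?xD // inE ?eqxx ?xD ?orbT.
Qed.

(** * Reductions that remove an input or a clause *)

Lemma amo_remove G F zs z : amo G F zs -> z \in zs ->
  amo (map neg [:: z] ++ G) (filter (predC (touch [:: z])) F) (rem z zs).
Proof.
move=> A zz; have [us hs hc] := A; apply: (amo_restrict A).
- exact: rem_uniq.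
- exact: mem_rem.
move=> y; rewrite (mem_rem_uniq _ us) inE => /andP[yz yzs].
have [a ma ay] := hs _ yzs; exists a => //=; rewrite ay andbT /=.
by apply: contra yz => az; apply/eqP; apply: hc ay az.
Qed.

Lemma occ_restrict_lt F Ds l c : c \in F -> inc l c -> touch Ds c ->
  occ (filter (predC (touch Ds)) F) l < occ F l.
Proof.
move=> cF i t; rewrite /occ count_filter -(size_filter (inc l) F).
rewrite -(count_predC (touch Ds)) !count_filter.
rewrite (@eq_count _ (predI (predC _) _) (predI (inc l) (predC (touch Ds)))).
  rewrite -[X in X < _]add0n ltn_add2r -has_count; apply/hasP; exists c => //=.
  by rewrite t.
by move=> x /=; rewrite andbC.
Qed.

(** If [neg z] occurs nowhere, [z] can be switched on in a model of another input, which is absurd.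
    If its only clause is [z -> p], drop it and let [p] stand for [z]: in a model with [p] true the
    dropped clause holds and [z] can be switched on, so [p] conflicts with all other inputs. *)
Lemma amo_replace G F zs z : amo G F zs -> 2 < size zs -> z \in zs ->
  occ F (neg z) <= 1 ->
  exists F' zs', [/\ amo G F' zs', size zs' = size zs & size F' < size F].
Proof.
move=> A ss zz; have [us hs hc] := A.
have key b w : model G F b -> tr b w -> w \in zs -> w != z ->
    {in F, forall c, inc (neg z) c -> tr (upd b z) (other (neg z) c)} -> False.
  move=> mb bw wz ne hF; have ng := amo_negunit A zz.
  have := hc _ _ wz zz _ (model_upd mb ng hF); rewrite !tr_upd eqxx bw andbT.
  have -> : w != neg z by apply: contraTneq wz => ->; exact: amo_neg A ss zz.
  by rewrite orbT => /(_ isT isT) /eqP; rewrite (negbTE ne).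
have [w wz /andP[wnz _]] := ex_third z z us ss.
rewrite leq_eqVlt ltnS leqn0 => /orP[o1|o0]; last first.
  have [b mb bw] := hs _ wz; exfalso; apply: (key b w) => // c cF i.
  by move: o0; rewrite eqn0Ngt -has_count => /hasPn/(_ _ cF); rewrite i.
have /hasP[c cF ic] : has (inc (neg z)) F by rewrite has_count -/(occ F _) (eqP o1).
have nF x : x \in rem c F -> inc (neg z) x = false.
  move=> xF; have := perm_to_rem cF => /permP/(_ (inc (neg z))).
  rewrite /= ic -/(occ F _) (eqP o1) => -[] /esym/eqP.
  by rewrite eqn0Ngt -has_count => /hasPn/(_ _ xF)/negbTE.
have sF a : model G F a -> model G (rem c F) a.
  by move=> /modelP[? hF]; apply/modelP; split=> // x /mem_rem; exact: hF.
pose p := other (neg z) c.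
have Fp a : model G F a -> tr a z -> tr a p.
  by move=> /modelP[_ /(_ _ cF)]; rewrite (holds_other _ ic) tr_neg => /orP[/negP|].
have conf y a : y \in rem z zs -> model G (rem c F) a -> tr a p -> tr a y -> False.
  rewrite (mem_rem_uniq _ us) inE => /andP[yz yzs] ma ap ay.
  have Fa : model G F a -> False.
    move=> mF; apply: (key a y) => // x xF ix.
    case: (eqVneq x c) => [->|xc].
      (* If [p] were [neg z], the clause would forbid [z] in every model. *)
      rewrite tr_upd ap andbT -/p; case: (eqVneq p (neg z)) => [e|]; last by rewrite orbT.
      have [b mb bz] := hs _ zz; by have := Fp _ mb bz; rewrite e tr_neg bz.
    have := perm_to_rem cF => /perm_mem/(_ x).
    by rewrite xF inE (negbTE xc) => /esym/nF; rewrite ix.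
  apply: Fa; apply/modelP; case/modelP: ma => ga fa; split=> // x.
  rewrite (perm_mem (perm_to_rem cF)) inE => /orP[/eqP->|/fa//].
  by rewrite (holds_other _ ic) ap orbT.
exists (rem c F), (p :: rem z zs); split; last by rewrite size_rem // prednK //; case: (F) cF.
- split.
  + rewrite /= rem_uniq // andbT; apply/negP => pz.
    by have [a ma az] := hs _ zz; apply: (conf p a); rewrite ?sF ?Fp.
  + move=> y; rewrite inE => /orP[/eqP->|/mem_rem yz].
      by have [a ma az] := hs _ zz; exists a; rewrite ?sF ?Fp.
    by have [a ma az] := hs _ yz; exists a; rewrite ?sF.
  + move=> y y'; rewrite !inE => /orP[/eqP->|yz] /orP[/eqP->|yz'] a ma ay ay' //.
    * by case: (conf y' a).
    * by case: (conf y a).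
    apply/eqP/negPn/negP => ne.
    move: (yz) (yz'); rewrite !(mem_rem_uniq _ us) !inE => /andP[n1 z1] /andP[n2 z2].
    have [a1 m1 b1] := hs _ z1; have [a2 m2 b2] := hs _ z2.
    (* [z] is false in [a1] and [a2], so their majority with [a] satisfies [c]. *)
    pose b := maj a a1 a2.
    have mb : model G F b.
      have /modelP[gb fb] := model_maj ma (sF _ m1) (sF _ m2).
      apply/modelP; split=> // x; rewrite (perm_mem (perm_to_rem cF)) inE => /orP[/eqP->|/fb//].
      rewrite (holds_other _ ic) tr_maj !tr_neg.
      have -> : tr a1 z = false.
        by apply/negP => h; move: n1; rewrite (hc _ _ z1 zz a1) ?eqxx.
      have -> : tr a2 z = false.
        by apply/negP => h; move: n2; rewrite (hc _ _ z2 zz a2) ?eqxx.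
      by rewrite /= !orbT.
    move: ne; rewrite (hc _ _ z1 z2 b) ?eqxx // tr_maj ?ay ?ay' ?b1 ?b2 ?orbT //.
by rewrite /= size_rem // prednK //; case: (zs) zz.
Qed.


(** Suppose a model [a] of the rest has two inputs [y], [y'] true. It must violate [c], so [z] is
    neither of them, and models of [F] with [y] or [y'] true satisfy [c] by its other literal. Their
    majority with [a] then satisfies [c] and keeps both [y] and [y'] true. *)
Lemma amo_clean G F zs c z : amo G F zs -> c \in F -> z \in zs -> inc z c ->
  amo G (rem c F) zs.
Proof.
move=> [us hs hc] cF zz ic.
have sF a : model G F a -> model G (rem c F) a.
  by move=> /modelP[? hF]; apply/modelP; split=> // x /mem_rem; exact: hF.
have sR a : model G (rem c F) a -> holds a c -> model G F a.
  move=> /modelP[ga fa] ha; apply/modelP; split=> // x.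
  by case/(mem_rem_cons cF) => [->|/fa].
split=> // [y /hs[a ma ay]|y y' yz yz' a ma ay ay']; first by exists a; rewrite ?sF.
apply/eqP/negPn/negP => ne.
have nh : ~~ holds a c.
  by apply/negP => /(sR _ ma)/(hc _ _ yz yz')/(_ ay ay')/eqP; rewrite (negbTE ne).
move: nh; rewrite (holds_other _ ic) negb_or => /andP[az ao].
have [a1 m1 b1] := hs _ yz; have [a2 m2 b2] := hs _ yz'.
have c1 w a' : w \in zs -> model G F a' -> tr a' w -> tr a w -> tr a' (other z c).
  move=> wz /[dup] ma' /modelP[_ /(_ _ cF)]; rewrite (holds_other _ ic).
  by case/orP => // a'z a'w aw; move: az; rewrite (hc _ _ zz wz a') ?aw.
have mm : model G F (maj a a1 a2).
  apply: sR; first by apply: model_maj => //; exact: sF.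
  by rewrite (holds_other _ ic) [tr _ (other _ _)]tr_maj (c1 y a1) ?(c1 y' a2) ?orbT.
move: ne; rewrite (hc _ _ yz yz' _ mm) ?eqxx // tr_maj ?ay ?ay' ?b1 ?b2 ?orbT //.
Qed.

(** If [neg u] occurs in no clause, setting [u] true costs nothing and removes [c0]. If its only
    clause is [u -> w], that clause disappears when [w] is substituted for [u], whose other
    occurrences are all positive. *)
Lemma amo_eliminate G F zs u a0 c0 : amo G F zs -> u \notin zs -> neg u \notin zs ->
  model G F a0 -> tr a0 u -> c0 \in F -> inc u c0 -> occ F (neg u) <= 1 ->
  exists G' F', amo G' F' zs /\ size F' < size F.
Proof.
move=> A uz nuz m0 t0 c0F ic0; have [us hs hc] := A.
have nuG : neg u \notin G.
  by apply/negP => h; case/modelP: m0 => /(_ _ h); rewrite tr_neg t0.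
rewrite leq_eqVlt ltnS leqn0 => /orP[o1|o0]; last first.
  exists (map neg [:: neg u] ++ G), (filter (predC (touch [:: neg u])) F).
  split; last first.
    rewrite -[X in _ < X](size_restrict F [:: neg u]) -[X in X < _]addn0 ltn_add2l.
    by rewrite -has_count; apply/hasP; exists c0 => //; rewrite /touch /= negK ic0.
  apply: (amo_restrict A) => // z zz; have [a ma az] := hs _ zz.
  exists (upd a u).
    apply: model_upd => // c cF i.
    by move: o0; rewrite eqn0Ngt -has_count => /hasPn/(_ _ cF); rewrite i.
  rewrite /= !andbT tr_neg negbK !tr_upd eqxx az /= !andbT; apply/orP; right.
  by apply: contraTneq zz => ->.
have /hasP[c cF ic] : has (inc (neg u)) F by rewrite has_count -/(occ F _) (eqP o1).
have nF x : x \in rem c F -> inc (neg u) x = false.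
  move=> xF; have := perm_to_rem cF => /permP/(_ (inc (neg u))).
  rewrite /= ic -/(occ F _) (eqP o1) => -[] /esym/eqP.
  by rewrite eqn0Ngt -has_count => /hasPn/(_ _ xF)/negbTE.
pose w := other (neg u) c.
have Fw a : model G F a -> tr a u -> tr a w.
  by move=> /modelP[_ /(_ _ cF)]; rewrite (holds_other _ ic) tr_neg => /orP[/negP|].
(* With [w = neg u] the clause would say that [u] is false, which [a0] refutes. *)
have wu : w != neg u by apply: contraTneq (Fw _ m0 t0) => ->; rewrite tr_neg t0.
pose sg l := if l == u then w else l.
have tsg a l : model G F a -> tr a l -> tr a (sg l).
  by rewrite /sg; case: eqP => // -> ma; exact: Fw.
(* A model of the substituted formula extends back by giving [u] the value of [w]. *)
pose lift a := if tr a w then upd a u else upd a (neg u).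
have trl a l : l != neg u -> tr (lift a) l = tr a (sg l).
  rewrite /lift /sg => lu; case: ifP => aw; rewrite tr_upd ?negK (negbTE lu) /=;
    by case: eqP => //= _; rewrite aw.
have trn a : tr (lift a) (neg u) = ~~ tr a w.
  by rewrite tr_neg trl 1?eq_sym ?neg_neq // /sg eqxx.
pose F' := [seq (sg x.1, sg x.2) | x <- rem c F].
have lm a : model (map sg G) F' a -> model G F (lift a).
  move=> /modelP[ga fa]; apply/modelP; split=> [l lG|x].
    by rewrite trl ?ga ?map_f //; apply: contraNneq nuG => <-.
  case/(mem_rem_cons cF) => [->|xF].
    rewrite (holds_other _ ic) trn -/w trl // /sg.
    by case: ifP => // _; rewrite orNb.
  have := nF _ xF; rewrite /inc => /negbT; rewrite negb_or => /andP[x1 x2].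
  rewrite /holds !trl //.
  by have := fa (sg x.1, sg x.2); apply; apply/mapP; exists x.
exists (map sg G), F'; split; last first.
  by rewrite size_map size_rem // prednK //; case: (F) cF.
have sgz z : z \in zs -> sg z = z /\ z != neg u.
  move=> zz; rewrite /sg; split; first by case: eqP => // e; rewrite -e zz in uz.
  by apply: contraTneq zz => ->.
split=> // [z zz|z z' zz zz' a ma az az'].
  have [a ma az] := hs _ zz; exists a => //; have /modelP[ga fa] := ma.
  apply/modelP; split=> [_ /mapP[l lG ->]|_ /mapP[x xF ->]].
    by apply: tsg => //; exact: ga.
  by have := fa _ (mem_rem xF); rewrite /holds /= => /orP[]/(tsg _ _ ma)->; rewrite ?orbT.
apply: (hc _ _ zz zz' _ (lm _ ma)).
  by have [e ne] := sgz _ zz; rewrite trl // e.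
by have [e ne] := sgz _ zz'; rewrite trl // e.
Qed.


(** * Partner literals of an irreducible formula *)

Definition partners F zs :=
  [seq other (neg z) c | z <- zs, c <- [seq c <- F | inc (neg z) c]].

Lemma partnersP F zs u : reflect
  (exists z c, [/\ z \in zs, c \in F, inc (neg z) c & u = other (neg z) c])
  (u \in partners F zs).
Proof.
apply: (iffP allpairsPdep) => -[z [c]].
  by case=> zz; rewrite mem_filter => /andP[ic cF] ->; exists z, c.
by case=> zz cF ic ->; exists z, c; rewrite mem_filter ic.
Qed.

(** Implication is taken semantically, over all models, and not along chains of clauses. *)
Definition reach G F zs u :=
  [seq z <- zs | `[< forall a, model G F a -> tr a z -> tr a u >]].

Lemma reachP G F zs u z : reflect
  (z \in zs /\ forall a, model G F a -> tr a z -> tr a u) (z \in reach G F zs u).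
Proof.
rewrite mem_filter; apply: (iffP andP) => -[].
  by move=> /asboolP.
by move=> ? ?; split=> //; apply/asboolP.
Qed.

(** The configuration left when none of the reductions on single inputs or on clauses containing
    inputs applies. *)
Definition irreducible G F zs : Prop :=
  [/\ amo G F zs, 2 < size zs, {in zs, forall z, occ F (neg z) = 2},
      {in F, forall c, {in zs &, forall z z', inc (neg z) c -> inc (neg z') c -> z = z'}}
    & {in F, forall c, {in zs, forall z, ~~ inc z c}}].

(** Inputs never occur positively. A negated input as partner would be that of [z] itself, since no
    clause serves two inputs, and then [z] would be unsatisfiable. *)
Lemma partners_notin G F zs u : irreducible G F zs -> u \in partners F zs ->
  u \notin zs /\ neg u \notin zs.
Proof.
move=> [[us hs hc] _ _ h2 h3] /partnersP[z [c [zz cF ic eu]]].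
have iu : inc u c by rewrite eu inc_other_l.
split; apply/negP => uz; first by have := h3 _ cF _ uz; rewrite iu.
have e : z = neg u by apply: (h2 c) => //; rewrite negK.
have [a /modelP[_ /(_ _ cF)]] := hs _ zz.
by rewrite (holds_other _ ic) -eu e negK tr_neg orbb => ->.
Qed.

(** Switching [z] on can only break its own two clauses, so it is safe as soon as both partners
    hold. *)
Lemma pair_partners G F zs z : irreducible G F zs -> z \in zs ->
  exists p q, [/\ p \in partners F zs, q \in partners F zs,
    forall a, model G F a -> tr a z -> tr a p && tr a q
  & forall a, model G F a -> tr a p -> tr a q -> model G F (upd a z)].
Proof.
move=> I zz; have [A ss h1 h2 h3] := I.
have := h1 _ zz; rewrite /occ -size_filter.
case E: (filter _ F) => [|c1 [|c2 []]] // _.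
have mF c : c \in [:: c1; c2] -> c \in F /\ inc (neg z) c.
  by rewrite -E mem_filter => /andP[].
have [c1F i1] : c1 \in F /\ inc (neg z) c1 by apply: mF; rewrite inE eqxx.
have [c2F i2] : c2 \in F /\ inc (neg z) c2 by apply: mF; rewrite !inE eqxx orbT.
have pP c : c \in F -> inc (neg z) c -> other (neg z) c \in partners F zs.
  by move=> cF ic; apply/partnersP; exists z, c.
exists (other (neg z) c1), (other (neg z) c2); split; rewrite ?pP //.
  move=> a /modelP[_ ma] az.
  by have := ma _ c1F; have := ma _ c2F; rewrite (holds_other _ i1) (holds_other _ i2)
    !tr_neg az /= => -> ->.
move=> a ma ap aq; apply: model_upd => //; first exact: amo_negunit A zz.
move=> c cF ic; rewrite tr_upd.
have [nz nnz] := partners_notin I (pP _ cF ic).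
have -> : other (neg z) c != neg z by rewrite -neg_eq; apply: contraNneq nnz => ->.
have : c \in [:: c1; c2] by rewrite -E mem_filter ic.
by rewrite !inE => /orP[] /eqP->; rewrite ?ap ?aq orbT.
Qed.

Definition input_off zs a : V -> bool :=
  fun v => if (v, true) \in zs then false else if (v, false) \in zs then true else a v.

Lemma tr_input_off zs a l : {in zs, forall z, neg z \notin zs} ->
  tr (input_off zs a) l = (l \notin zs) && ((neg l \in zs) || tr a l).
Proof.
move=> nz; case: l => v b; have := nz (v, true); rewrite /tr /input_off /neg /=.
by case: b; case: ((v, true) \in zs); case: ((v, false) \in zs) => //= /(_ isT).
Qed.

(** Inputs occur only negated in clauses and are not units, so falsifying all of them preserves a
    model. *)
Lemma model_input_off G F zs a : irreducible G F zs -> model G F a ->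
  model G F (input_off zs a).
Proof.
move=> [A ss _ _ h3] /modelP[ga fa]; have [us _ _] := A.
have nz : {in zs, forall z, neg z \notin zs} by move=> z; exact: amo_neg A ss.
apply/modelP; split=> [l lG|c cF].
  rewrite tr_input_off // ga // orbT andbT; apply/negP => lz.
  have [y yz /andP[yl _]] := ex_third l l us ss.
  by have := amo_unit A lz yz; rewrite eq_sym yl lG => /(_ isT).
have n1 : c.1 \notin zs by apply: contraTN (cF) => h; apply/negP => /h3/(_ _ h); rewrite /inc eqxx.
have n2 : c.2 \notin zs by apply: contraTN (cF) => h; apply/negP => /h3/(_ _ h); rewrite /inc eqxx orbT.
rewrite /holds !tr_input_off // n1 n2 /=.
by have := fa _ cF; rewrite /holds => /orP[]->; rewrite !orbT.
Qed.

(** * A partner literal implied by as few inputs as possible *)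

Section Source.
Variables (G : seq lit) (F : seq clause) (zs : seq lit) (u : lit).
Hypothesis I : irreducible G F zs.
Hypothesis uL : u \in partners F zs.
Hypothesis umin :
  {in partners F zs, forall v, size (reach G F zs u) <= size (reach G F zs v)}.
Let Z := reach G F zs u.

Lemma reach_uniq : uniq Z.
Proof. by case: I => -[us _ _] *; rewrite filter_uniq. Qed.

Lemma reach_gt0 : 0 < size Z.
Proof.
have /partnersP[z [c [zz cF ic eu]]] := uL.
suff : z \in Z by case: (Z).
apply/reachP; split=> // a /modelP[_ /(_ _ cF)].
by rewrite (holds_other _ ic) tr_neg -eu => /orP[/negP|].
Qed.

(** The inputs implying [p] all lie in [Z], and by minimality of [u] they exhaust it. *)
Lemma reach_source p z a : p \in partners F zs ->
  (forall a, model G F a -> tr a p -> tr a u) -> z \in Z ->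
  model G F a -> tr a z -> tr a p.
Proof.
move=> pL pu zZ.
have up : uniq (reach G F zs p) by case: I => -[us _ _] *; rewrite filter_uniq.
have sub : {subset reach G F zs p <= Z}.
  by move=> y /reachP[yz yp]; apply/reachP; split=> // b mb /(yp _ mb); exact: pu.
have [_ e] := uniq_min_size up sub (umin pL).
by move: zZ; rewrite -e => /reachP[_]; exact.
Qed.

(** An input outside [Z] has a model with [u] false, and there every input of [Z] is false too. *)
Lemma amo_without_source :
  amo (map neg (u :: Z) ++ G) (filter (predC (touch (u :: Z))) F)
    (filter (predC (mem Z)) zs).
Proof.
have [A _ _ _ _] := I; have [us hs hc] := A.
apply: (amo_restrict A); first exact: filter_uniq.
  by move=> z; rewrite mem_filter => /andP[].
move=> z; rewrite mem_filter => /andP[/= zZ zz].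
have [a [ma [az au]]] : exists a, model G F a /\ (tr a z /\ ~ tr a u).
  apply: contra_notP (negP zZ) => h; apply/reachP; split=> // a ma az.
  by apply: contra_notT h => /negP au; exists a.
exists a => //; rewrite az (introN idP au) /=; apply/allP => y /reachP[yz yu].
by apply/negP => ay; exact: au (yu _ ma ay).
Qed.

(** The counts add up because no clause contains both [neg u] and [neg z] for [z] in [Z]: it would
    say that [z] excludes [u]. *)
Lemma size_without_source :
  size (filter (predC (touch (u :: Z))) F) + 2 * size Z + occ F (neg u) = size F.
Proof.
have [[us hs _] ss h1 h2 _] := I.
have [uz nuz] := partners_notin I uL.
have sub z : z \in Z -> z \in zs by case/reachP.
have uZ c z : c \in F -> z \in Z -> inc (neg u) c -> inc (neg z) c -> False.
  move=> cF /reachP[zz zu] iu iz; have [a ma az] := hs _ zz.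
  have nuz' : neg u != neg z by rewrite (inj_eq (can_inj negK)); apply: contraNneq uz => ->.
  have := zu _ ma az; case/modelP: ma => _ /(_ _ cF).
  by rewrite (holds_other _ iu) (inc2_other iu iz nuz') !tr_neg az orbF => /negbTE->.
rewrite -[RHS](size_restrict F (u :: Z)) -addnA count_touch.
- rewrite big_cons [occ F (neg u) + _]addnC; congr (_ + (_ + _)).
  rewrite (eq_big_seq (fun=> 2)); last by move=> z /sub; exact: h1.
  by rewrite big_const_seq count_predT iter_addn_0.
- by rewrite /= reach_uniq andbT; apply: contra uz => /sub.
move=> c cF x y; rewrite !inE => /orP[/eqP->|xZ] /orP[/eqP->|yZ] ix iy //.
- by case: (uZ c y).
- by case: (uZ c x).
by apply: (h2 c); rewrite // sub.
Qed.

(* Each [z] implied by the source has one partner equivalent to the source on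
   [Z], so the conflicts inside [Z] must come from the other partners. *)
Lemma amo_second_partners : 1 < size Z ->
  exists2 qs, size qs = size Z &
    amo (map neg (u :: zs) ++ G) (filter (predC (touch (u :: zs))) F) qs.
Proof.
move=> Z1; have [A ss h1 h2 h3] := I; have [us hs hc] := A.
have ex z : exists pq : lit * lit, z \in Z ->
    [/\ pq.1 \in partners F zs, pq.2 \in partners F zs,
        forall z' a, z' \in Z -> model G F a -> tr a z' -> tr a pq.1,
        forall a, model G F a -> tr a z -> tr a pq.2
      & forall a, model G F a -> tr a pq.1 -> tr a pq.2 -> model G F (upd a z)].
  have [zZ|zZ] := boolP (z \in Z); last by exists (u, u) => h; case/negP: zZ.
  have /reachP[zz zu] := zZ.
  have [p [q [pL qL zpq updz]]] := pair_partners I zz.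
  have [pu|npu] := pselect (forall a, model G F a -> tr a p -> tr a u).
    exists (p, q) => _; split=> //= [z' a z'Z|a ma /(zpq _ ma)/andP[]//].
    exact: reach_source pL pu z'Z.
  have [qu|nqu] := pselect (forall a, model G F a -> tr a q -> tr a u).
    exists (q, p) => _; split=> //= [z' a z'Z|a ma /(zpq _ ma)/andP[]//|a ma aq ap].
      exact: reach_source qL qu z'Z.
    exact: updz.
  (* If neither [p] nor [q] implied [u], the majority of a model with [p] but not [u], one with [q]
     but not [u], and one of [z] would have [p] and [q] true and [u] false. Switching [z] on there
     contradicts [z] being in [Z]. *)
  exfalso.
  have wit r : ~ (forall a, model G F a -> tr a r -> tr a u) ->
      exists a, [/\ model G F a, tr a r & tr a u = false].
    move=> h; apply: contra_notP h => h a ma ar.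
    by apply: contra_notT h => /negbTE au; exists a.
  have [a1 [m1 p1 u1]] := wit _ npu; have [a2 [m2 q2 u2]] := wit _ nqu.
  have [a3 m3 z3] := hs _ zz; have /andP[p3 q3] := zpq _ m3 z3.
  have mm := updz _ (model_maj m1 m2 m3).
  rewrite !tr_maj p1 q2 p3 q3 !orbT in mm.
  have := zu _ (mm isT isT); rewrite !tr_upd eqxx [tr _ u]tr_maj u1 u2 /= andbF orbF.
  move=> /(_ isT)/eqP e; have [uz _] := partners_notin I uL.
  by rewrite e zz in uz.
have [f fP] := choice ex; pose q z := (f z).2.
have qL z : z \in Z -> q z \in partners F zs by case/fP.
(* In the majority of [a] with models of [z] and [z'], the first partners hold because all of [Z]
   implies them, and the second ones because [a] has both. So [z] and [z'] can be switched on
   together. *)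
have conf z z' a : z \in Z -> z' \in Z -> model G F a -> tr a (q z) -> tr a (q z') ->
    z = z'.
  move=> zZ z'Z ma aq aq'.
  have [/= _ _ pz zq updz] := fP _ zZ; have [/= pL' qL' pz' zq' updz'] := fP _ z'Z.
  have /reachP[zz _] := zZ; have /reachP[zz' _] := z'Z.
  have [a1 m1 z1] := hs _ zz; have [a2 m2 z2] := hs _ zz'.
  pose b := maj a a1 a2; have mb : model G F b by exact: model_maj.
  have bp : tr b (f z).1 by rewrite tr_maj (pz z a1) // (pz z' a2) // !orbT.
  have bp' : tr b (f z').1 by rewrite tr_maj (pz' z a1) // (pz' z' a2) // !orbT.
  have bq : tr b (q z) by rewrite tr_maj aq (zq a1).
  have bq' : tr b (q z') by rewrite tr_maj aq' (zq' a2) // orbT.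
  have keep m : m \notin zs -> neg m \notin zs -> tr (upd b z) m = tr b m.
    move=> mz nmz; rewrite tr_upd -neg_eq.
    have -> : m == z = false by apply: contraNF mz => /eqP->.
    by have -> : neg m == z = false by apply: contraNF nmz => /eqP->.
  have m' : model G F (upd (upd b z) z').
    have [n1 n2] := partners_notin I pL'; have [n3 n4] := partners_notin I qL'.
    by apply: updz'; rewrite ?keep //; exact: updz.
  apply: hc m' _ _ => //; rewrite !tr_upd eqxx //= andbT; apply/orP; right.
  by apply: contraTneq zz => ->; exact: amo_neg A ss zz'.
have sat z : z \in Z -> exists a,
    [/\ model G F a, tr a (q z) & all (fun d => ~~ tr a d) (u :: zs)].
  move=> zZ; have [_ /= qz pz zq updz] := fP _ zZ.
  (* If [q z] implied [u], all of [Z] would imply [q z], and a model of another [z'] in [Z] would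
     satisfy both [q z] and [q z']. *)
  have [a [ma aq au]] : exists a, [/\ model G F a, tr a (q z) & ~~ tr a u].
    apply: contrapT => h.
    have qu a : model G F a -> tr a (q z) -> tr a u.
      by move=> ma aq; apply: contra_notT h => au; exists a.
    have : exists2 z', z' \in Z & z' != z.
      apply: contrapT => h'; have sub : {subset Z <= [:: z]}.
        by move=> y yZ; rewrite inE; apply: contra_notT h' => ne; exists y.
      by have := uniq_leq_size reach_uniq sub; rewrite leqNgt Z1.
    case=> z' z'Z /negP; apply; apply/eqP.
    have /reachP[zz' _] := z'Z; have [b mb bz'] := hs _ zz'.
    have [_ _ _ zq' _] := fP _ z'Z.
    by apply: (conf z' z b) => //; [exact: zq' | exact: reach_source qz qu z'Z mb bz'].
  have nz : {in zs, forall z, neg z \notin zs} by move=> y; exact: amo_neg A ss.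
  exists (input_off zs a); split; first exact: model_input_off.
    by have [n1 n2] := partners_notin I qz; rewrite tr_input_off // n1 aq orbT.
  have [_ n2] := partners_notin I uL; apply/andP; split.
    by rewrite tr_input_off // (negbTE n2) (negbTE au) andbF.
  by apply/allP => d dz; rewrite tr_input_off // dz.
exists (map q Z); first by rewrite size_map.
split.
- rewrite map_inj_in_uniq ?reach_uniq // => z z' zZ z'Z e.
  have /reachP[zz _] := zZ; have [a ma az] := hs _ zz.
  have [_ _ _ zq _] := fP _ zZ.
  by apply: (conf z z' a) => //; rewrite -?e; exact: zq.
- move=> _ /mapP[z zZ ->]; have [a [ma aq aD]] := sat _ zZ.
  by exists a; rewrite ?model_restrict ?ma.
move=> _ _ /mapP[z zZ ->] /mapP[z' z'Z ->] a; rewrite model_restrict => /andP[ma _] aq aq'.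
by rewrite (conf z z' a).
Qed.

End Source.

(** * Clause counts and the induction on the number of clauses *)

Lemma count_touch1 F z : count (touch [:: z]) F = occ F (neg z).
Proof. by apply: eq_count => c; rewrite /touch /= orbF. Qed.

Lemma touch_zs G F zs : irreducible G F zs -> count (touch zs) F = 2 * size zs.
Proof.
move=> [[us _ _] _ h1 h2 _]; rewrite count_touch //.
rewrite (eq_big_seq (fun=> 2)) //.
by rewrite big_const_seq count_predT iter_addn_0.
Qed.

(** A clause containing both [neg u] and a negated input would make [neg u] a partner, so the two
    kinds of clauses are disjoint. *)
Lemma touch_source G F zs u : irreducible G F zs -> u \in partners F zs ->
  neg u \notin partners F zs ->
  count (touch (u :: zs)) F = 2 * size zs + occ F (neg u).
Proof.
move=> I uL nuL; have [[us _ _] _ h1 h2 _] := I.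
have [uz nuz] := partners_notin I uL.
rewrite -(touch_zs I) addnC /occ -count_predUI -[LHS]addn0; congr (_ + _).
apply/esym/eqP; rewrite -leqn0 leqNgt -has_count; apply/hasPn => c cF /=.
apply/negP => /andP[iu /hasP[z zz iz]]; case/negP: nuL; apply/partnersP.
exists z, c; split=> //; apply/esym/inc2_other => //.
by rewrite (inj_eq (can_inj negK)); apply: contraNneq uz => <-.
Qed.

Lemma amo_lower_bound G F zs : amo G F zs -> size_bound (size zs) (size F).
Proof.
have [k] := ubnP (size F); elim: k G F zs => // k IHk G F zs sF A.
have IH G' F' zs' : amo G' F' zs' -> size F' < size F -> size_bound (size zs') (size F').
  by move=> A' s'; apply: IHk A'; apply: leq_trans s' _.
have IHs G' F' zs' : amo G' F' zs' -> size F' < size F -> size zs' = size zs ->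
    size_bound (size zs) (size F).
  by move=> A' s' e; apply: (size_bound_mono (ltnW s')); rewrite -e; exact: IH A' s'.
have [ss|ss] := leqP (size zs) 2; first exact: size_bound_small.
have [us hs hc] := A.
have [y yz] : exists y, y \in zs.
  by case: (zs) ss => // y s _; exists y; rewrite inE eqxx.
have [/hasP[z zz o1]|/hasPn o1] := boolP (has (fun z => occ F (neg z) <= 1) zs).
  by have [F' [zs' [A' e s']]] := amo_replace A ss zz o1; exact: IHs A' s' e.
have [s3|s3] := leqP (size zs) 3.
  have -> : size zs = 3 by lia.
  rewrite /size_bound /= ltnNge; apply/negP => sF2.
  (* With at most two clauses, each [neg z] lies in every clause, but a clause has no room for three
     literals. *)
  have allF z : z \in zs -> all (inc (neg z)) F.
    move=> /o1; rewrite -ltnNge all_count -/(occ F _) => o2.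
    by rewrite eqn_leq count_size (leq_trans sF2).
  have [c cF] : exists c, c \in F.
    case: (F) o1 => [/(_ _ yz)//|c F' _]; exists c; exact: mem_head.
  have sub : {subset map neg zs <= [:: c.1; c.2]}.
    move=> _ /mapP[z /allF/allP/(_ _ cF) ic ->].
    by rewrite !inE ![neg z == _]eq_sym.
  have := uniq_leq_size _ sub; rewrite (map_inj_uniq (can_inj negK)) size_map.
  by rewrite leqNgt ss => /(_ us).
have step G' F' zs' : amo G' F' zs' -> size F' + 3 <= size F -> size zs' = (size zs).-1 ->
    size_bound (size zs) (size F).
  move=> A' s' e; apply: (@size_bound_step _ (size F')) => //.
  by rewrite -e; apply: IH A' _; lia.
have [/hasP[z zz o3]|/hasPn o3] := boolP (has (fun z => 2 < occ F (neg z)) zs).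
  apply: (step _ _ _ (amo_remove A zz)); last exact: size_rem.
  by rewrite -[X in _ <= X](size_restrict F [:: z]) count_touch1 leq_add2l.
have o2 z : z \in zs -> occ F (neg z) = 2.
  by move=> zz; have := o1 _ zz; have := o3 _ zz; lia.
have [/hasP[c cF /hasP[z zz ic]]|/hasPn h3] :=
    boolP (has (fun c => has (fun z => inc z c) zs) F).
  apply: (IHs _ _ _ (amo_clean A cF zz ic)) => //.
  by rewrite size_rem // prednK //; case: (F) cF.
have [/hasP[c cF /hasP[z zz /hasP[z' zz' /and3P[ne iz iz']]]]|/hasPn h2] :=
    boolP (has (fun c => has (fun z => has (fun z' =>
      [&& z != z', inc (neg z) c & inc (neg z') c]) zs) zs) F).
  (* Setting [z'] false deletes its two clauses, one of them shared with [z], so [z] keeps at most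
     one clause and replacing it saves a third. *)
  have A' := amo_remove A zz'.
  have sr : size (rem z' zs) = (size zs).-1 by exact: size_rem.
  have ss' : 2 < size (rem z' zs) by lia.
  have zr : z \in rem z' zs by rewrite (mem_rem_uniq _ us) !inE ne.
  have occ1 : occ (filter (predC (touch [:: z'])) F) (neg z) <= 1.
    by rewrite -ltnS -(o2 _ zz); apply: (occ_restrict_lt cF iz); rewrite /touch /= iz'.
  have [F' [zs' [A'' e s']]] := amo_replace A' ss' zr occ1.
  apply: (step _ _ _ A''); last by rewrite e.
  rewrite -[X in _ <= X](size_restrict F [:: z']) count_touch1 o2 //.
  by rewrite -[3]/(1 + 2) addnA leq_add2r addn1.
have I : irreducible G F zs.
  split=> // [c cF z z' zz zz' iz iz'|c cF z zz].
    apply/eqP/negPn/negP => ne; case/negP: (h2 _ cF); apply/hasP; exists z => //.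
    by apply/hasP; exists z'; rewrite // ne iz.
  by apply/negP => ic; case/negP: (h3 _ cF); apply/hasP; exists z.
have [u uL umin] : exists2 u, u \in partners F zs &
    {in partners F zs, forall v, size (reach G F zs u) <= size (reach G F zs v)}.
  have [u0 [_ [u0L _ _ _]]] := pair_partners I yz.
  have ex : exists d, has (fun v => size (reach G F zs v) == d) (partners F zs).
    by exists (size (reach G F zs u0)); apply/hasP; exists u0.
  case: (ex_minnP ex) => d /hasP[u uL /eqP e] dmin; exists u => // v vL.
  by rewrite e; apply: dmin; apply/hasP; exists v.
have [uz nuz] := partners_notin I uL.
have /partnersP[z0 [c0 [zz0 c0F ic0 eu]]] := uL.
have iu0 : inc u c0 by rewrite eu inc_other_l.
have [a0 m0 az0] := hs _ zz0.
have au0 : tr a0 u.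
  by case/modelP: m0 => _ /(_ _ c0F); rewrite (holds_other _ ic0) -eu tr_neg az0.
have [ou|ou] := leqP (occ F (neg u)) 1.
  by have [G' [F' [A' s']]] := amo_eliminate A uz nuz m0 au0 c0F iu0 ou; exact: IHs A' s' _.
set Z := reach G F zs u in umin.
have Zu : uniq Z by exact: reach_uniq I.
have Z0 : 0 < size Z by exact: reach_gt0.
have Zs : {subset Z <= zs} by move=> z /reachP[].
have Zn : size Z <= size zs := uniq_leq_size Zu Zs.
have A2 := @amo_without_source _ _ _ u I.
have e2 := size_without_source I uL.
set F2 := filter (predC (touch (u :: Z))) F in A2 e2.
have g2 : size_bound (size zs - size Z) (size F2).
  have -> : size zs - size Z = size (filter (predC (mem Z)) zs).
    rewrite -(count_predC (mem Z) zs) [RHS]size_filter; set x := count _ _.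
    have -> : x = size Z.
      rewrite /x /Z /reach size_filter.
      by apply: eq_in_count => v vz /=; rewrite mem_filter vz andbT.
    by rewrite addKn.
  apply: IH A2 _; rewrite -e2 -addnA -[X in X < _]addn0 ltn_add2l addn_gt0.
  by rewrite (ltnW ou) orbT.
pose F3 := filter (predC (touch (u :: zs))) F.
have e3 : size F3 + 2 * size zs <= size F.
  rewrite -[size F](size_restrict F (u :: zs)) -/F3 leq_add2l -(touch_zs I).
  by apply: sub_count => c /=; rewrite /touch /= => ->; rewrite orbT.
have g3 : size_bound (size Z) (size F3).
  have [Z1|Z1] := leqP (size Z) 1; first exact/size_bound_small/ltnW.
  have [qs <- A3] := amo_second_partners I uL umin Z1.
  apply: IH A3 (leq_trans _ e3); rewrite -[X in X < _]addn0 ltn_add2l muln_gt0.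
  exact: leq_trans ss.
have fin : (size F2 + 2 * size Z + 3 <= size F) || (2 * size zs + size F3 + 2 <= size F) ->
    size_bound (size zs) (size F).
  apply: (size_bound_source _ _ g2 g3) => //; rewrite ?Z0 //.
    by rewrite -e2 leq_add2l.
  by rewrite addnC.
(* If [neg u] is not a partner, its clauses, at least two, come on top of the [2 * size zs] input
   clauses and improve the second inequality by 2. *)
have [nuL|nuL] := boolP (neg u \in partners F zs); last first.
  apply: fin; apply/orP; right; rewrite -[size F](size_restrict F (u :: zs)) -/F3.
  by rewrite (touch_source I) // addnA [size F3 + _]addnC leq_add2l.
(* A third clause with [neg u] improves the first inequality by 1. *)
have [ou3|ou2] := leqP 3 (occ F (neg u)).
  by apply: fin; rewrite -[X in _ + 3 <= X]e2 leq_add2l ou3.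
(* Now [neg u] has exactly two clauses, one of them [z -> neg u]. Setting [z] false deletes two
   clauses including this one, and then [u] can be eliminated, which saves a third. The input [z0],
   which implies [u], differs from [z], so [a0] and [c0] survive. *)
have /partnersP[z [c [zz cF ic enu]]] := nuL.
have inu : inc (neg u) c by rewrite enu inc_other_l.
have A' := amo_remove A zz.
have zz00 : z0 != z.
  apply: contraTneq au0 => e; case/modelP: m0 => _ /(_ _ cF).
  by rewrite (holds_other _ ic) -enu tr_neg -e az0 /= tr_neg.
have [G' [F' [A'' s']]] : exists G' F', amo G' F' (rem z zs) /\
    size F' < size (filter (predC (touch [:: z])) F).
  apply: (@amo_eliminate _ _ _ u a0 c0 A') => //.
  - by apply: contra uz; exact: mem_rem.
  - by apply: contra nuz; exact: mem_rem.
  - rewrite model_restrict m0 /= andbT; apply/negP => az.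
    by move: zz00; rewrite (hc _ _ zz0 zz a0) ?eqxx.
  - rewrite mem_filter c0F andbT /touch /= orbF; apply/negP => iz.
    have [_ _ _ h2' _] := I; move: zz00; rewrite (h2' _ c0F z0 z) ?eqxx //.
  have t : touch [:: z] c by rewrite /touch /= ic.
  by rewrite -ltnS; apply: leq_trans (occ_restrict_lt cF inu t) _.
apply: (step _ _ _ A''); last exact: size_rem.
rewrite -[X in _ <= X](size_restrict F [:: z]) count_touch1 o2 //.
by rewrite -[3]/(1 + 2) addnA leq_add2r addn1.
Qed.

End TwoCnf.

(** * From encodings to pairs of literals *)

Lemma exists_lit2 (V : finType) (a : V -> bool) (l m : V * bool) :
  [exists x in [set l; m], eval_lit a x] = eval_lit a l || eval_lit a m.
Proof.
apply/exists_inP/orP => [[x]|].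
  by rewrite !inE => /orP[]/eqP-> ?; [left | right].
by case=> h; [exists l | exists m]; rewrite // !inE eqxx ?orbT.
Qed.

(** The all-false input is accepted, so [phi] is satisfiable and has no empty clause. Hence each
    clause is a pair, with its literal repeated if it has only one. *)
Lemma amo_of_encoding n l (phi : cnf ('I_n + 'I_l)%type) : 0 < n ->
  is_2cnf phi -> encodes phi (@AMO n) ->
  exists2 F, size F = #|phi| & amo [::] F [seq (inl i : 'I_n + 'I_l, true) | i <- enum 'I_n].
Proof.
move=> n0 /andP[_ /forall_inP two] enc.
have [b0 e0] : exists b, eval_cnf (assign [ffun=> false] b) phi.
  by apply/enc; apply/card_le1_eqP => i j; rewrite inE ffunE.
have ex C : exists lm : literal ('I_n + 'I_l) * literal ('I_n + 'I_l),
    C \in phi -> C = [set lm.1; lm.2].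
  have [Cp|Cp] := boolP (C \in phi); last first.
    by exists ((inl (Ordinal n0), true), (inl (Ordinal n0), true)) => h; case/negP: Cp.
  have /exists_inP[x xC _] := forall_inP e0 _ Cp.
  have := two _ Cp; rewrite (cardsD1 x) xC add1n ltnS => /card_le1_eqP h.
  have [D0|[y yD]] := set_0Vmem (C :\ x).
    by exists (x, x) => _; rewrite -(setD1K xC) D0 setUC set0U /= setUid.
  exists (x, y) => _; rewrite -(setD1K xC) /=; congr (_ |: _); apply/setP => z.
  rewrite in_set1; apply/idP/eqP => [zD|-> //]; exact: h.
have [f fP] := choice ex.
have eval a : model [::] [seq f C | C <- enum phi] a = eval_cnf a phi.
  rewrite /model /= all_map; apply/allP/forall_inP => h C Cp.
    have := h C; rewrite mem_enum => /(_ Cp) /=.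
    by rewrite {2}(fP _ Cp) exists_lit2.
  by rewrite mem_enum in Cp; have := h _ Cp; rewrite {1}(fP _ Cp) exists_lit2.
exists [seq f C | C <- enum phi]; first by rewrite size_map -cardE.
split.
- by rewrite map_inj_uniq ?enum_uniq // => i j [].
- move=> _ /mapP[i _ ->].
  have [b eb] : exists b, eval_cnf (assign [ffun j => j == i] b) phi.
    apply/enc; apply/card_le1_eqP => j k; rewrite !inE !ffunE.
    by move=> /eqP-> /eqP->.
  by exists (assign [ffun j => j == i] b); rewrite ?eval // /tr /= ffunE eqxx.
move=> _ _ /mapP[i _ ->] /mapP[j _ ->] a; rewrite eval /tr /= => ea /eqP ai /eqP aj.
have /enc/card_le1_eqP h : exists b : {ffun 'I_l -> bool},
    eval_cnf (assign [ffun i => a (inl i)] b) phi.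
  exists [ffun k => a (inr k)].
  suff -> : assign [ffun i => a (inl i)] [ffun k => a (inr k)] = a by [].
  by apply/funext => -[k|k] /=; rewrite ffunE.
by rewrite (h i j) // inE ffunE ?ai ?aj.
Qed.

(** * The sequential encoding for [m.+3] inputs *)

Section Sequential.
Variable m : nat.
Let V := ('I_m.+3 + 'I_m)%type.

(* [partial k] stands for the disjunction of the inputs [0 .. k]. *)
Definition input k : V := inl (inord k).
Definition partial k : V :=
  if k is j.+1 then oapp inr (inl ord0) (insub j) else inl ord0.

Definition clause2 (x y : literal V) : {set literal V} := [set x; y].
Definition conflict_clause k := clause2 (partial k, false) (input k.+1, false).
Definition carry_clause k := clause2 (partial k, false) (partial k.+1, true).
Definition input_clause k := clause2 (input k.+1, false) (partial k.+1, true).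

(** The chain stops at [partial m]: the triple [partial m], [input m.+1], [input m.+2] is made
    pairwise conflicting directly, which brings the count to [3 * m + 3]. *)
Definition sequential_clauses : seq {set literal V} :=
  [seq conflict_clause k | k <- iota 0 m.+1] ++ [seq carry_clause k | k <- iota 0 m] ++
  [seq input_clause k | k <- iota 0 m] ++
  [:: clause2 (partial m, false) (input m.+2, false);
      clause2 (input m.+1, false) (input m.+2, false)].

Definition sequential : cnf V := [set:: sequential_clauses].

Lemma card_sequential : #|sequential| <= 3 * m.+3 - 6.
Proof.
rewrite cardsE; apply: leq_trans (card_size _) _.
by rewrite !size_cat !size_map !size_iota /=; lia.
Qed.

Lemma partialS k (km : k < m) : partial k.+1 = inr (Ordinal km).
Proof. by rewrite /partial insubT. Qed.

Lemma sequential_2cnf : is_2cnf sequential.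
Proof.
have cl2 (v w : V) (b d : bool) : (v != w) || (b == d) -> is_clause (clause2 (v, b) (w, d)).
  move=> h; apply/forallP => x; apply/negP; rewrite !inE !xpair_eqE => /andP[].
  by case: (eqVneq v w) h => [->|]; case: (eqVneq x v) => [->|]; case: b; case: d => //=;
    rewrite ?andbT ?andbF ?orbF ?eqxx //= => /negbTE->.
have all2 C : C \in sequential_clauses -> is_clause C.
  rewrite !mem_cat => /or4P[/mapP[k _ ->]|/mapP[k]|/mapP[k]|].
  - by apply: cl2; rewrite eqxx orbT.
  - rewrite mem_iota add0n => /= km ->; apply: cl2; rewrite (partialS km) orbF.
    case: k km => [//|k] km; rewrite (partialS (ltnW km)); apply/eqP => -[]; lia.
  - by rewrite mem_iota add0n => /= km ->; apply: cl2; rewrite (partialS km).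
  by rewrite !inE => /orP[]/eqP->; apply: cl2; rewrite eqxx orbT.
apply/andP; split; apply/forall_inP => C; rewrite inE; first exact: all2.
rewrite !mem_cat => /or4P[/mapP[k _ ->]|/mapP[k _ ->]|/mapP[k _ ->]|];
  rewrite ?cards2 ?ltnS ?leq_b1 //.
by rewrite !inE => /orP[]/eqP->; rewrite cards2 ltnS leq_b1.
Qed.

Lemma eval_sequential (a : V -> bool) : reflect
  [/\ forall k, k <= m -> ~~ (a (partial k) && a (input k.+1)),
      forall k, k < m -> a (partial k) || a (input k.+1) -> a (partial k.+1)
    & ~~ (a (input m.+2) && (a (partial m) || a (input m.+1)))]
  (eval_cnf a sequential).
Proof.
apply: (iffP forall_inP) => [h|[h1 h2 h3] C].
  have h' C : C \in sequential_clauses -> [exists x in C, eval_lit a x].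
    by move=> hC; apply: h; rewrite inE.
  split=> [k km|k km|].
  - have := h' (conflict_clause k); rewrite !mem_cat map_f ?mem_iota //= => /(_ isT).
    by rewrite exists_lit2 /eval_lit /= negb_and !eqbF_neg.
  - have := h' (carry_clause k); rewrite !mem_cat (map_f carry_clause) ?mem_iota ?orbT //=.
    move/(_ isT); have := h' (input_clause k).
    rewrite !mem_cat (map_f input_clause) ?mem_iota ?orbT //= => /(_ isT).
    rewrite !exists_lit2 /eval_lit /= !eqbF_neg !eqb_id.
    by case: (a (partial k.+1)); rewrite ?orbF // => /negbTE-> /negbTE->.
  have := h' (clause2 (partial m, false) (input m.+2, false)).
  rewrite !mem_cat mem_head !orbT => /(_ isT).
  have := h' (clause2 (input m.+1, false) (input m.+2, false)).
  rewrite !mem_cat !inE eqxx !orbT => /(_ isT).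
  rewrite !exists_lit2 /eval_lit /= !eqbF_neg.
  by case: (a (input m.+2)); case: (a (partial m)); case: (a (input m.+1)).
rewrite inE !mem_cat => /or4P[/mapP[k]|/mapP[k]|/mapP[k]|].
- rewrite mem_iota add0n => /= km ->; rewrite exists_lit2 /eval_lit /= !eqbF_neg.
  by rewrite -negb_and h1.
- rewrite mem_iota add0n => /= km ->; rewrite exists_lit2 /eval_lit /= !eqbF_neg eqb_id.
  by case E: (a (partial k)) => //=; apply: h2; rewrite ?E.
- rewrite mem_iota add0n => /= km ->; rewrite exists_lit2 /eval_lit /= !eqbF_neg eqb_id.
  by case E: (a (input k.+1)) => //=; apply: h2; rewrite ?E ?orbT.
move: h3; rewrite !inE => h3.
by case/orP=> /eqP->; rewrite exists_lit2 /eval_lit /= !eqbF_neg; move: h3;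
  case: (a (input m.+2)); case: (a (partial m)); case: (a (input m.+1)).
Qed.

Lemma sequential_encodes : encodes sequential (@AMO m.+3).
Proof.
move=> a; split=> [/card_le1_eqP amoa|[b /eval_sequential[h1 h2 h3]]].
  have uni (i j : nat) : i < j < m.+3 -> a (inord i) -> a (inord j) -> False.
    move=> /andP[ij jm] ai aj; have := amoa (inord i) (inord j).
    rewrite !inE => /(_ ai aj)/(congr1 val) /=; rewrite !inordK; lia.
  (* The auxiliary variable [j] is [partial j.+1], hence the bound [j.+1]. *)
  pose b := [ffun j : 'I_m => [exists i : 'I_m.+3, a i && (i <= j.+1)]].
  have ab k : k <= m -> assign a b (partial k) = [exists i : 'I_m.+3, a i && (i <= k)].
    case: k => [_|k km]; last by rewrite (partialS km) /= ffunE.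
    apply/idP/existsP => [/= a0|[i /andP[ai]]]; first by exists ord0; rewrite a0.
    by rewrite leqn0 => /eqP i0; rewrite /= (_ : ord0 = i) //; apply: val_inj.
  have abI k j : k <= m -> k < j < m.+3 -> assign a b (partial k) -> a (inord j) -> False.
    move=> km kj; rewrite ab // => /existsP[i /andP[ai ik]].
    by apply: (uni i j); rewrite ?inord_val //; lia.
  exists b; apply/eval_sequential; split=> [k km|k km|].
  - by apply/negP => /andP[]; apply: abI; lia.
  - rewrite (ab k.+1) // ab 1?ltnW // => /orP[/existsP[i /andP[ai ik]]|ak].
      by apply/existsP; exists i; rewrite ai; lia.
    by apply/existsP; exists (inord k.+1); rewrite (ak : a (inord k.+1)) inordK //; lia.
  apply/negP => /andP[a2 /orP[a1|a1]]; first by apply: (abI m m.+2) => //; lia.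
  by apply: (uni m.+1 m.+2) => //; lia.
(* The clauses force [partial k] only upwards from true inputs, which is all that the conflicts
   require. *)
have up (k i : nat) : i <= k <= m -> a (inord i) -> assign a b (partial k).
  elim: k => [|k IH] /andP[ik km] ai.
    by move: ik ai; rewrite leqn0 => /eqP->; rewrite (_ : inord 0 = ord0) //; apply: val_inj; rewrite /= inordK.
  apply: h2 => //; move: ik; rewrite leq_eqVlt => /orP[/eqP e|ik].
    by rewrite /input /= -e ai orbT.
  by rewrite IH // -ltnS ik ltnW.
have uni (i j : 'I_m.+3) : i < j -> a i -> a j -> False.
  move=> ij ai aj; have jm := ltn_ord j; case/negP: h3; rewrite /input /=.
  (* The last input is covered by the two extra clauses, every other [j] by a conflict clause of the
     chain. *)
  have [j2|j2] := eqVneq (val j) m.+2.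
    have -> : inord m.+2 = j by apply: val_inj; rewrite /= inordK.
    rewrite aj /=; have [im|im] := leqP i m.
      by rewrite (up m i) // ?inord_val ?im ?leqnn.
    have -> : inord m.+1 = i by apply: val_inj; rewrite /= inordK //; lia.
    by rewrite ai orbT.
  move: ij jm j2; rewrite /=; case ek: (nat_of_ord j) => [//|k] ij km k2.
  have ej : inord k.+1 = j by apply: val_inj; rewrite /= inordK.
  have kle : k <= m by lia.
  case/negP: (h1 k kle); rewrite /input /= ej aj andbT.
  by apply: (up k i); rewrite ?inord_val // -ltnS ij.
apply/card_le1_eqP => i j; rewrite !inE => ai aj; apply: val_inj => /=.
by case: (ltngtP i j) => // ij; case: (uni _ _ ij).
Qed.

End Sequential.

(** * The two bounds on [S2] *)

Lemma S2_lower n : size_bound n (S2 n).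
Proof.
case: (posnP n) => [->|n0]; first exact: size_bound_small.
rewrite /S2; case: ex_minnP => s /asboolP[l [phi [two enc <-]]] _.
have [F <- A] := amo_of_encoding n0 two enc.
by have := amo_lower_bound A; rewrite size_map size_enum_ord.
Qed.

Lemma S2_upper n : 2 < n -> S2 n <= 3 * n - 6.
Proof.
case: n => [|[|[|m]]] // _; apply: leq_trans (card_sequential m).
rewrite /S2; case: ex_minnP => s _; apply; apply/asboolP.
exists m, (sequential m); split=> //; first exact: sequential_2cnf.
exact: sequential_encodes.
Qed.

Theorem theorem4 (R : realType) (n : nat) (hn : (3 <= n)%N) :
  ((n <= 10)%N -> S2 n = (3 * n - 6)%N) /\
  ((9 <= n)%N -> (2 * n%:R + 2 * Num.sqrt n%:R - 3 <= (S2 n)%:R :> R)%R).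
Proof.
have lo := S2_lower n; split=> [n10|n9].
  by apply/eqP; rewrite eqn_leq S2_upper //=; move: lo; rewrite /size_bound n10.
(* For [n = 9] and [n = 10] the linear bound gives this as well: [6 ^ 2 = 4 * 9] and
   [7 ^ 2 > 4 * 10]. *)
have h : 4 * n <= (S2 n + 3 - 2 * n) ^ 2.
  move: lo; rewrite /size_bound; case: ifP => // n10 lo.
  have : n - 3 <= S2 n + 3 - 2 * n by lia.
  rewrite -(leq_exp2r _ _ (isT : 0 < 2)); apply: leq_trans.
  by have [->|->] : n = 9 \/ n = 10 by lia.
(* Otherwise the truncated difference in [h] would be 0. *)
have le : 2 * n <= S2 n + 3.
  by rewrite leqNgt; apply/negP => lt; move: h; rewrite (_ : _ - _ = 0) //; lia.
set k := S2 n + 3 - 2 * n in h.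
have -> : ((S2 n)%:R = 2 * n%:R + k%:R - 3 :> R)%R.
  have : S2 n + 3 = 2 * n + k by rewrite /k; lia.
  move/(congr1 (fun x => x%:R : R)%R); rewrite /= natrD [RHS]natrD natrM => e.
  by rewrite -e addrK.
rewrite lerD2r lerD2l.
(* Writing both sides as square roots leaves the comparison [h] of the radicands. *)
rewrite -[(k%:R)%R]ger0_norm ?ler0n // -sqrtr_sqr.
have -> : (2 * Num.sqrt n%:R = Num.sqrt (4 * n%:R) :> R)%R.
  by rewrite sqrtrM ?ler0n // (_ : 4 = 2 ^+ 2)%R ?sqrtr_sqr ?ger0_norm ?ler0n // -natrX.
by apply: ler_wsqrtr; rewrite -natrX -natrM ler_nat.
Qed.
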